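(* Let $A:\ell^2\to Y$ be an injective bounded linear operator into the infinite dimensional Banach space $Y$, with adjoint $A^*:Y^*\to\ell^2$ and with range not closed in $Y$. Let $y\in{\rm Range}(A)$ be such that the unique solution $x^\dagger$ of $Ax=y$ lies in $\ell^0$ and has non-empty finite support $I=\{i\in\mathbb N:x^\dagger_i\neq0\}$. Assume that for every $i\in\mathbb N$ there exists $\omega_i\in Y^*$ with $e^{(i)}=A^*\omega_i$. Let $1<q<\infty$ and, for $\eta,\alpha,\delta>0$ and $y^\delta\in Y$ with $\|y-y^\delta\|\le\delta$, let $x_{\alpha,\eta}^\delta$ be a minimizer over $x\in\ell^2$ of $$\frac1q\|Ax-y^\delta\|^q+\alpha\Big(\|x\|_{\ell^0}+\frac{\eta}{2}\|x\|_{\ell^2}^2\Big).$$ Fix a sufficiently large bound $\rho>0$, set $\mathcal M:=\{x\in\ell^0:\|x\|_{\ell^2}\le\rho\}$, and let $$K:=\sum_{i\in I}\|\omega_i\|_{Y^*},\qquad \underline\kappa:=\min_{i\in I}|x_i^\dagger|,\qquad c_0(\eta):=K\left(\frac1\rho+\frac1{\underline\kappa}+\eta\|x^\dagger\|_{\ell^\infty}\right).$$ Let $\alpha_0>0$ be sufficiently large, $0<\nu<1$, $\tau>1$, $\alpha_j:=\nu^j\alpha_0$ and $\Delta_\nu:=\{\alpha_j:j=1,2,\dots\}$. Suppose that $\alpha_*=\alpha_{j_*}\in\Delta_\nu$ is chosen (sequential discrepancy principle) according to $$\|Ax_{\alpha_{j_*},\eta}^\delta-y^\delta\|\le\tau\delta<\|Ax_{\alpha_{j_*-1},\eta}^\delta-y^\delta\|,$$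 and that $x_{\alpha_{j_*},\eta}^\delta\in\mathcal M$. Then the $\ell^1$ error estimate $$\|x_{\alpha_{j_*},\eta}^\delta-x^\dagger\|_{\ell^1}\le C_2\,\delta$$ holds true with the constant $$C_2=\rho\,c_0(\eta)\left[\left(\frac2{\tau-1}\right)^{q-1}\frac{\tau^q+1}{\tau^q-1}\,\frac1\nu+\tau+1\right].$$
   Context: $\ell^0$ is the set of real sequences with finitely many nonzero components. For a sequence $x$, $\|x\|_{\ell^0}=\sum_{i=1}^\infty \operatorname{sgn}(|x_i|)$ is the number of its nonzero components ($+\infty$ if $x\notin\ell^0$). $e^{(i)}$ is the $i$-th standard unit sequence in $\ell^2$. $\|\cdot\|$ is the norm of $Y$, and $Y^*$ is the dual of $Y$. The dual of $\ell^2$ is identified with $\ell^2$, so that $\langle A^*w,x\rangle=\langle w,Ax\rangle_{Y^*\times Y}$. *)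

(* Defs.v *)
From HB Require Import structures.
From mathcomp Require Import all_boot all_order all_algebra.
From mathcomp Require Import all_classical all_reals all_analysis.
From mathcomp Require Import ring lra.
Set Implicit Arguments.
Unset Strict Implicit.
Unset Printing Implicit Defensive.
Import Order.TTheory GRing.Theory Num.Theory.
Import numFieldNormedType.Exports.
Local Open Scope classical_set_scope.
Local Open Scope ring_scope.

Section SquareSummable.
Variable R : realType.
Implicit Types x y : nat -> R.

Definition square_summable : {pred nat -> R} :=
  [pred x : nat -> R | `[< cvgn (series (fun i => x i ^+ 2)) >]].

Lemma square_summableP x :
  reflect (cvgn (series (fun i => x i ^+ 2))) (x \in square_summable).
Proof. exact: asboolP. Qed.

Lemma square_summable_mul x y : x \in square_summable -> y \in square_summable ->
  cvgn (series (fun i => x i * y i)).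
Proof.
move=> /square_summableP cx /square_summableP cy; apply: normed_cvg.
apply: (@series_le_cvg _ _ (fun i => x i ^+ 2 + y i ^+ 2)) => [i|i|i|].
- exact: normr_ge0.
- by rewrite addr_ge0 ?sqr_ge0.
- rewrite ler_norml; apply/andP.
  by split; have := sqr_ge0 (x i + y i); have := sqr_ge0 (x i - y i); nra.
- have -> : series (fun i => x i ^+ 2 + y i ^+ 2) =
      series (fun i => x i ^+ 2) + series (fun i => y i ^+ 2).
    by apply/funext => n; rewrite /series/= big_split.
  exact: is_cvgD.
Qed.

Lemma square_summable_submod : submod_closed square_summable.
Proof.
split=> [|a x y xs ys]; apply/square_summableP.
  have -> : series (fun i => (0 : nat -> R) i ^+ 2) = cst 0.
    apply/funext => n; rewrite /series/= big1// => i _.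
    by rewrite -[(0 : nat -> R) i]/(0 : R) expr0n.
  exact: is_cvg_cst.
have -> : series (fun i => (a *: x + y) i ^+ 2) =
    (a ^+ 2 \*: series (fun i => x i ^+ 2)) +
    ((a * 2) \*: series (fun i => x i * y i)) + series (fun i => y i ^+ 2).
  apply/funext => n; rewrite -[RHS]/(a ^+ 2 * (\sum_(0 <= i < n) x i ^+ 2) +
    (a * 2) * (\sum_(0 <= i < n) x i * y i) + \sum_(0 <= i < n) y i ^+ 2).
  rewrite /series/= !mulr_sumr -!big_split/=; apply: eq_bigr => i _.
  by rewrite -[(a *: x + y) i]/(a * x i + y i); ring.
apply: is_cvgD; last exact/square_summableP.
apply: is_cvgD; apply: is_cvgZr; first exact/square_summableP.
exact: square_summable_mul.
Qed.

HB.instance Definition _ := GRing.isSubmodClosed.Build R (nat -> R)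
  square_summable square_summable_submod.

End SquareSummable.

Record ell2 (R : realType) := Ell2 {
  ell2_seq :> nat -> R ;
  ell2P : ell2_seq \in @square_summable R }.

HB.instance Definition _ (R : realType) := [isSub for @ell2_seq R].
HB.instance Definition _ (R : realType) := [Choice of ell2 R by <:].
HB.instance Definition _ (R : realType) :=
  [SubChoice_isSubLmodule of ell2 R by <:].

Section Ell2Norm.
Variable R : realType.
Implicit Types x y : ell2 R.

Definition ell2_dot x y : R := limn (series (fun i => x i * y i)).

Definition ell2_norm x : R := Num.sqrt (limn (series (fun i => x i ^+ 2))).

Lemma cvg_ell2_dot x y : cvgn (series (fun i => x i * y i)).
Proof. by apply: square_summable_mul; exact: ell2P. Qed.

Lemma ell2_normE x : ell2_norm x = Num.sqrt (ell2_dot x x).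
Proof. by []. Qed.

Lemma ell2_dotC x y : ell2_dot x y = ell2_dot y x.
Proof.
by rewrite /ell2_dot; under eq_fun do rewrite mulrC.
Qed.

Lemma ell2_dotl a x y z :
  ell2_dot (a *: x + y) z = a * ell2_dot x z + ell2_dot y z.
Proof.
rewrite /ell2_dot.
have -> : series (fun i => (a *: x + y) i * z i) =
    (a \*: series (fun i => x i * z i)) + series (fun i => y i * z i).
  apply/funext => n; rewrite -[RHS]/(a * (\sum_(0 <= i < n) x i * z i) +
    \sum_(0 <= i < n) y i * z i).
  rewrite /series/= !mulr_sumr -!big_split/=; apply: eq_bigr => i _.
  by transitivity ((a * x i + y i) * z i); [|ring].
have cx := @cvg_ell2_dot x z; have cy := @cvg_ell2_dot y z.
rewrite limD//; last exact: is_cvgZr.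
by congr (_ + _); exact: limZr.
Qed.

Lemma sqr_le_ell2_dot x i : x i ^+ 2 <= ell2_dot x x.
Proof.
have nd : nondecreasing_seq (series (fun k => x k * x k)).
  by apply: nondecreasing_series => k _ _; exact: sqr_ge0.
apply: le_trans (nondecreasing_cvgn_le nd (@cvg_ell2_dot x x) i.+1).
rewrite /series/= big_nat_recr//= lerDr sumr_ge0// => k _; exact: sqr_ge0.
Qed.

Lemma ell2_dot_ge0 x : 0 <= ell2_dot x x.
Proof. exact: le_trans (sqr_ge0 _) (sqr_le_ell2_dot x 0). Qed.

Lemma ell2_CauchySchwarz x y :
  ell2_dot x y ^+ 2 <= ell2_dot x x * ell2_dot y y.
Proof.
set a := ell2_dot x x; set b := ell2_dot x y; set c := ell2_dot y y.
have a0 : 0 <= a by exact: ell2_dot_ge0.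
have c0 : 0 <= c by exact: ell2_dot_ge0.
have H t : 0 <= t ^+ 2 * a + 2 * t * b + c.
  have := ell2_dot_ge0 (t *: x + y).
  rewrite ell2_dotl (ell2_dotC x) (ell2_dotC y (t *: x + y)) !ell2_dotl.
  by rewrite (ell2_dotC y x) -/a -/b -/c; lra.
have [a_eq0|a_neq0] := eqVneq a 0.
  have [->|b_neq0] := eqVneq b 0; first by rewrite a_eq0 expr0n mul0r.
  have := H (- (c + 1) / (2 * b)).
  rewrite a_eq0 mulr0 add0r.
  have -> : 2 * (- (c + 1) / (2 * b)) * b = - (c + 1) by field.
  by lra.
have agt0 : 0 < a by rewrite lt_def a_neq0.
have := H (- b / a).
have -> : (- b / a) ^+ 2 * a + 2 * (- b / a) * b + c = (a * c - b ^+ 2) / a.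
  by field.
by rewrite pmulr_lge0 ?invr_gt0// subr_ge0.
Qed.

Lemma ell2_normD x y : ell2_norm (x + y) <= ell2_norm x + ell2_norm y.
Proof.
rewrite -ler_sqr ?nnegrE ?addr_ge0 ?sqrtr_ge0// sqrrD !ell2_normE.
rewrite !sqr_sqrtr ?ell2_dot_ge0//.
have dotD (u v z : ell2 R) : ell2_dot (u + v) z = ell2_dot u z + ell2_dot v z.
  by have := ell2_dotl 1 u v z; rewrite scale1r mul1r.
rewrite dotD !(ell2_dotC _ (x + y)) !dotD (ell2_dotC y x).
rewrite -sqrtrM ?ell2_dot_ge0//.
have /(le_trans (ler_norm _)) : `|ell2_dot x y| <=
    Num.sqrt (ell2_dot x x * ell2_dot y y).
  by rewrite -sqrtr_sqr ler_wsqrtr// ell2_CauchySchwarz.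
by lra.
Qed.

Lemma ell2_normZ a x : ell2_norm (a *: x) = `|a| * ell2_norm x.
Proof.
have dot0 z : ell2_dot 0 z = 0.
  have := ell2_dotl 1 0 0 z; rewrite scaler0 addr0 mul1r => /eqP.
  by rewrite -subr_eq subrr => /eqP.
have dotZ b (u v : ell2 R) : ell2_dot (b *: u) v = b * ell2_dot u v.
  by rewrite -[b *: u]addr0 ell2_dotl dot0 addr0.
rewrite !ell2_normE dotZ ell2_dotC dotZ mulrA -expr2 sqrtrM ?sqr_ge0//.
by rewrite sqrtr_sqr.
Qed.

Lemma ell2_norm0_eq0 x : ell2_norm x = 0 -> x = 0.
Proof.
move/eqP; rewrite ell2_normE sqrtr_eq0 => x0.
apply/val_inj/funext => i /=; apply/eqP; rewrite -sqrf_eq0 eq_le sqr_ge0 andbT.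
exact: le_trans (sqr_le_ell2_dot _ _) x0.
Qed.

End Ell2Norm.

HB.instance Definition _ (R : realType) := Lmodule_isNormed.Build R (ell2 R)
  (@ell2_normD R) (@ell2_normZ R) (@ell2_norm0_eq0 R).

Lemma ell2_normrE (R : realType) (x : ell2 R) : `|x| = ell2_norm x.
Proof. by []. Qed.

Lemma ell2_unit_subproof (R : realType) (i : nat) :
  (fun k => (k == i)%:R) \in @square_summable R.
Proof.
apply/square_summableP.
apply: (is_cvg_near_cst (1 : R)); exists i.+1 => // n /= ni.
rewrite /series/= (bigD1_seq i) ?mem_index_iota ?iota_uniq//= eqxx expr1n.
by rewrite big1 ?addr0// => k /negbTE ->; rewrite expr0n.
Qed.

Definition ell2_unit (R : realType) (i : nat) : ell2 R :=
  Ell2 (ell2_unit_subproof R i).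

Section SequenceNotions.
Variable R : realType.
Implicit Types x : nat -> R.

Definition supp x : set nat := [set i | x i != 0].

Definition ell0 : set (nat -> R) := [set x | finite_set (supp x)].

Definition l0norm x : \bar R := (\sum_(i <oo) (Num.sg `|x i|)%:E)%E.

Definition l1norm x : \bar R := (\sum_(i <oo) `|x i|%:E)%E.

(* Only meaningful for bounded x, as is every element of ell2. *)
Definition linfnorm x : R := sup (range (fun i => `|x i|)).

(* The infimum is attained, i.e. it is the minimum, as soon as supp x is
   finite and nonempty. *)
Definition min_supp x : R := inf [set `|x i| | i in supp x].

End SequenceNotions.

Section Dual.
Variables (R : realType) (Y : normedModType R).

Record dual := Dual {
  dual_fun :> {linear Y -> R^o} ;
  dual_continuous : continuous dual_fun }.

Definition dual_norm (w : dual) : R :=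
  sup [set `|w v| | v in [set v : Y | `|v| <= 1]].

(* Adjoint with the dual of ell2 identified with ell2. *)
Definition is_adjoint (A : ell2 R -> Y) (Astar : dual -> ell2 R) :=
  forall (w : dual) (x : ell2 R), ell2_dot (Astar w) x = w (A x).

Definition infinite_dimensional :=
  ~ exists (n : nat) (b : 'I_n -> Y),
      forall v, exists c : 'I_n -> R, v = \sum_(i < n) c i *: b i.

End Dual.

Section Tikhonov.
Variables (R : realType) (Y : normedModType R).

Definition tikhonov (A : ell2 R -> Y) (yd : Y) (q alpha eta : R)
    (x : ell2 R) : \bar R :=
  ((q^-1 * `|A x - yd| `^ q)%R%:E +
   alpha%:E * (l0norm x + (eta / 2 * `|x| ^+ 2)%R%:E))%E.

Definition is_minimizer (T : Type) (F : T -> \bar R) (x : T) :=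
  forall z, (F x <= F z)%E.

Definition sparse_ball (rho : R) : set (ell2 R) :=
  [set x : ell2 R | ell0 (x : nat -> R) /\ `|x| <= rho].

Definition source_const (xdag : ell2 R) (omega : nat -> dual Y) : R :=
  \sum_(i \in supp xdag) dual_norm (omega i).

Definition c0_const (rho eta : R) (xdag : ell2 R) (omega : nat -> dual Y) : R :=
  source_const xdag omega *
  (rho^-1 + (min_supp xdag)^-1 + eta * linfnorm xdag).

Definition C2_const (rho c0 q tau nu : R) : R :=
  rho * c0 *
  ((2 / (tau - 1)) `^ (q - 1) * ((tau `^ q + 1) / (tau `^ q - 1)) * nu^-1
   + tau + 1).

End Tikhonov.

(* Main.v *)
Require Import Defs.
From HB Require Import structures.
From mathcomp Require Import all_boot all_order all_algebra.
From mathcomp Require Import all_classical all_reals all_analysis.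
From mathcomp Require Import ring lra.
Set Implicit Arguments.
Unset Strict Implicit.
Unset Printing Implicit Defensive.
Import Order.TTheory GRing.Theory Num.Theory.
Import numFieldNormedType.Exports.
Local Open Scope classical_set_scope.
Local Open Scope ring_scope.

(** The variational inequality behind the estimate is elementary and coordinatewise.
Let [kappa = min_supp xdag] and let [beta >= 0] satisfy [beta * |x_i| <= 1]
for all [i].  Off the support of [xdag] a nonzero coordinate of [x] costs one
unit of the l0-norm, which pays for [beta * |x_i|]; on the support, deleting a
coordinate of [xdag] gains one unit, but only by moving at least [kappa], so
that the gain is at most [|x_i - xdag_i| / kappa].  Hence
[[
  beta * l1norm (x - xdag) + l0norm xdag
    <= l0norm x + (beta + 1 / kappa) * \sum_(i in supp xdag) |x_i - xdag_i|
]]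
([l0norm_lower_bound]).  The quadratic term is convex with derivative supported
on [supp xdag], so that it adds at most [eta * linfnorm xdag] times the same
finite sum ([quad_lower_bound_supp]).  Each coordinate on the support is a
continuous functional of [A (x - xdag)] through the source elements
([source_bound]), which gives [penalty_source_inequality]: the l1-error is
controlled by the excess penalty of [x] plus a multiple of
[|A x - A xdag|].

Combined with minimality this yields, for [t = |A x - yd|] at a minimizer [x]
with parameter [alpha] ([tikhonov_minimizer_bound]),
[[
  t^q / q + alpha * beta * l1norm (x - xdag)
    <= delta^q / q + alpha * c * (t + delta),
]]
where [c] is [c0_const] with [beta] in place of [1 / rho].
This is used twice.  At the accepted parameter [alpha], with [beta = 1 / rho],
it bounds the l1-error by [rho] times [delta^q / (q alpha) + c0 (tau + 1) delta].
What remains is to bound [alpha] from below.  The previous, rejected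
parameter [alpha / nu] has [t > tau * delta], but its minimizer may lie outside
the ball of radius [rho]; there [beta = 0] is the admissible choice, and it gives
[t^q - delta^q <= q (alpha / nu) c0 (t + delta)].  The scalar estimate
[powR_quotient_bound] on [(t + delta) / (t^q - delta^q)] turns this into the
required lower bound on [alpha]. *)

(** * Coordinates and finite supports in the sequence space *)

Section Ell2Facts.
Variable R : realType.
Implicit Types x z : ell2 R.

Lemma ell2_dot_finsupp x z : ell0 (x : nat -> R) ->
  ell2_dot x z = \sum_(i \in supp x) x i * z i.
Proof.
move=> fx.
have [N xN] : exists N, supp x `<=` `I_N.
  have /finite_seqP [s xs] := fx.
  exists (\max_(i <- s) i).+1 => i; rewrite xs /= => si.
  by rewrite ltnS (big_rem i)//= leq_maxl.
apply: lim_near_cst => //; exists N => // n /= Nn.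
rewrite /series /= big_mkord (fsbig_ord _ n (fun i => x i * z i)).
apply/esym/fsbig_widen => [i /xN /leq_trans|i [_ /= /negP]]; first exact.
by rewrite negbK => /eqP ->; rewrite mul0r.
Qed.

Lemma ell2_dot_unit i z : ell2_dot (ell2_unit R i) z = z i.
Proof.
have uE : supp (ell2_unit R i) = [set i].
  by apply/seteqP; split=> k; rewrite /supp/= pnatr_eq0 eqb0 negbK => /eqP.
rewrite ell2_dot_finsupp /ell0/= uE ?fsbig_set1//=.
by rewrite eqxx mul1r.
Qed.

Lemma ell2_norm_sqr x : `|x| ^+ 2 = ell2_dot x x.
Proof. by rewrite ell2_normrE ell2_normE sqr_sqrtr// ell2_dot_ge0. Qed.

Lemma ell2_coord_le x i : `|x i| <= `|x|.
Proof.
by rewrite -ler_sqr ?nnegrE// ell2_norm_sqr -normrX ger0_norm ?sqr_ge0// sqr_le_ell2_dot.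
Qed.

Lemma ell2_coordB x z i : (x - z) i = x i - z i.
Proof. by []. Qed.

Lemma le_linfnorm x i : `|x i| <= linfnorm x.
Proof.
apply: ub_le_sup; last by exists i.
by exists `|x| => _ [k _ <-]; exact: ell2_coord_le.
Qed.

Lemma min_supp_le x i : supp x i -> min_supp x <= `|x i|.
Proof.
move=> xi; apply: ge_inf; last by exists i.
by exists 0 => _ [k _ <-].
Qed.

(** The infimum is bounded below by the minimum over an enumeration of the
finite support, seeded with a point of the support. *)
Lemma min_supp_gt0 x : ell0 (x : nat -> R) -> supp x !=set0 ->
  0 < min_supp x.
Proof.
move=> /finite_seqP[s xs] [i0 xi0].
have sP i : i \in s <-> supp x i by rewrite xs.
have s0 i : i \in s -> 0 < `|x i| by rewrite normr_gt0 => /sP.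
have /sP i0s := xi0.
pose m := \big[Order.min/`|x i0|]_(i <- s) `|x i|.
apply: (@lt_le_trans _ _ m).
  rewrite /m big_seq; elim/big_ind : _ => [|u v u0 v0|]; rewrite ?s0//.
  by rewrite lt_min u0.
apply: lb_le_inf; first by exists `|x i0|, i0.
move=> _ [i xi <-]; apply: ge_bigmin_seq => //; exact/sP.
Qed.

(** The tangent to the convex function [|x|^2 / 2] at [z] lies below its graph,
which is the expansion of [0 <= |x - z|^2]. *)
Lemma quad_lower_bound x z :
  ell2_dot z (x - z) <= 2^-1 * `|x| ^+ 2 - 2^-1 * `|z| ^+ 2.
Proof.
have := ell2_dot_ge0 (x - z); rewrite !ell2_norm_sqr.
have E (u : ell2 R) : ell2_dot (x - z) u = ell2_dot x u - ell2_dot z u.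
  by rewrite addrC -[- z]scaleN1r ell2_dotl mulN1r addrC.
rewrite [ell2_dot z _]ell2_dotC E (ell2_dotC x (x - z)) (ell2_dotC z (x - z)).
by rewrite !E (ell2_dotC z x); lra.
Qed.

End Ell2Facts.

(** * The operator norm of a functional *)

Section DualNorm.
Variables (R : realType) (Y : normedModType R) (w : dual Y).

Lemma dual_has_ubound : has_ubound [set `|w v| | v in [set v : Y | `|v| <= 1]].
Proof.
have := @continuous_linear_bounded _ _ _ 0 w (@dual_continuous _ _ w 0).
move=> /linear_boundedP/pinfty_ex_gt0 [r r0 wr].
exists r => _ [u /= u1 <-]; apply: le_trans (wr _) _.
by rewrite ler_piMr// ltW.
Qed.

Lemma dual_norm_ge v : `|w v| <= dual_norm w * `|v|.
Proof.
have [->|v0] := eqVneq v 0; first by rewrite linear0 !normr0 mulr0.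
have nv : 0 < `|v| by rewrite normr_gt0.
rewrite -ler_pdivrMr//.
apply: (ub_le_sup dual_has_ubound); exists (`|v|^-1 *: v) => /=.
  by rewrite normrZ normfV normr_id mulVf ?gt_eqF.
by rewrite linearZ/= normrZ normfV normr_id mulrC.
Qed.

Lemma dual_norm_ge0 : 0 <= dual_norm w.
Proof.
apply: (ub_le_sup dual_has_ubound); exists 0 => /=; first by rewrite normr0 ler01.
by rewrite linear0 normr0.
Qed.

End DualNorm.

(** * Scalar power estimates *)

Lemma powRV (R : realType) (a r : R) : 0 <= a -> a^-1 `^ r = (a `^ r)^-1.
Proof. by move=> a0; rewrite -powR_inv1// -powRrM mulN1r powRN. Qed.

Lemma powR_pred (R : realType) (a r : R) : 0 < a -> a `^ r = a `^ (r - 1) * a.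
Proof.
move=> a0; rewrite -{1}[r](subrK 1) (powRD (r := r - 1)) ?powRr1 ?ltW//.
by rewrite (gt_eqF a0) implybT.
Qed.

(** Convexity of the power function at the midpoint of [a] and [b]. *)
Lemma powRD_le (R : realType) (q a b : R) : 1 <= q -> 0 <= a -> 0 <= b ->
  (a + b) `^ q <= 2 `^ (q - 1) * (a `^ q + b `^ q).
Proof.
move=> q1 a0 b0.
have half0 : 0 <= 2^-1 :> R by lra.
have half1 : 2^-1 <= 1 :> R by lra.
have := @convex_powR R q q1 (Itv01 half0 half1) a b.
rewrite !inE /= !in_itv /= a0 b0 => /(_ isT isT).
rewrite convRE [X in X `^ _ <= _ -> _]convRE /= /unstable.onem.
have -> : 1 - 2^-1 = 2^-1 :> R by lra.
rewrite -!mulrDr powRM ?addr_ge0//.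
have -> : 2^-1 `^ q = 2^-1 * (2 `^ (q - 1))^-1 :> R.
  by rewrite powR_pred ?invr_gt0// powRV// mulrC.
have p0 : 0 < 2 `^ (q - 1) :> R by rewrite powR_gt0.
rewrite -mulrA ler_pM2l; last by lra.
by rewrite ler_pdivrMl.
Qed.

(** Up to the factor [d ^ (q - 1)], this bounds [(t + d) / (t^q - d^q)].
Multiplying by [(t - d)^(q - 1)], of which [((tau - 1) d)^(q - 1)] is a lower
bound, raises the numerator to at most [(t + d)^q], which convexity compares
with [t^q + d^q]; and [(s + 1) / (s - 1)] decreases in [s = (t / d)^q], where
[s >= tau^q]. *)
Lemma powR_quotient_bound (R : realType) (q tau t d : R) : 1 < q -> 1 < tau -> 0 < d ->
  tau * d <= t ->
  d `^ (q - 1) * (t + d) <=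
  (2 / (tau - 1)) `^ (q - 1) * ((tau `^ q + 1) / (tau `^ q - 1)) *
    (t `^ q - d `^ q).
Proof.
move=> q1 tau1 d0 tdt.
have q0 : 0 < q by lra.
have dt : d < t by apply: lt_le_trans tdt; rewrite ltr_pMl.
have tauq : 1 < tau `^ q.
  by have := @gt0_ltr_powR R q q0 1 tau; rewrite !nnegrE powR1 => -> //; lra.
have tq : tau `^ q * d `^ q <= t `^ q.
  rewrite -powRM; [|lra..].
  by apply: ge0_ler_powR; rewrite ?nnegrE ?mulr_ge0; lra.
have dq : 0 < d `^ q by rewrite powR_gt0.
have conv := @powRD_le R q t d (ltW q1) (ltW (lt_trans d0 dt)) (ltW d0).
have taud : ((tau - 1) * d) `^ (q - 1) * (t + d) <= (t + d) `^ q.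
  have td0 : 0 < t + d by lra.
  rewrite (powR_pred q td0) ler_wpM2r ?(ltW td0)//.
  apply: ge0_ler_powR; rewrite ?nnegrE ?mulr_ge0; lra.
have tau1q : 0 < (tau - 1) `^ (q - 1) by rewrite powR_gt0//; lra.
rewrite powRM in taud; [|lra..].
rewrite powRM; [|lra|rewrite invr_ge0; lra].
have -> : (tau - 1)^-1 `^ (q - 1) = ((tau - 1) `^ (q - 1))^-1.
  by rewrite powRV//; lra.
rewrite -!mulrA -(ler_pM2l tau1q).
set P2 := 2 `^ (q - 1) in conv *; set T := (tau - 1) `^ (q - 1) in taud tau1q *.
have P20 : 0 < P2 by rewrite powR_gt0.
have -> : T * (P2 * (T^-1 * ((tau `^ q + 1) * ((tau `^ q - 1)^-1 * (t `^ q - d `^ q)))))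
  = P2 * ((tau `^ q + 1) * (t `^ q - d `^ q) / (tau `^ q - 1)).
  by field; rewrite (gt_eqF tau1q)/= gt_eqF//; lra.
rewrite -mulrA in taud; apply: le_trans taud (le_trans conv _).
rewrite ler_pM2l// ler_pdivlMr; last lra.
by lra.
Qed.

(** * Lower bounds on the penalty *)

Section Penalty.
Variable R : realType.
Implicit Types x z : ell2 R.

Definition penalty (eta : R) x : \bar R :=
  (l0norm x + (eta / 2 * `|x| ^+ 2)%R%:E)%E.

Lemma nneseries_finsupp (D : set nat) (f : nat -> R) : finite_set D ->
  (forall i, 0 <= f i) -> (forall i, ~ D i -> f i = 0) ->
  (\sum_(i <oo) (f i)%:E = (\sum_(i \in D) f i)%R%:E)%E.
Proof.
move=> fD f0 fD0; rewrite nneseries_esum => [|i _]; last by rewrite lee_fin.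
rewrite -fsumEFin// -esum_fset => [|//|i _]; last by rewrite lee_fin.
have -> : [set x | xpredT x] = [set: nat] by apply/seteqP.
rewrite [RHS]esum_mkcond; apply: eq_esum => i _.
by case: ifPn => // /negP; rewrite inE => /fD0 ->.
Qed.

Lemma l0norm_ge0 x : (0 <= l0norm x)%E.
Proof. by apply: nneseries_ge0 => i _ _; rewrite lee_fin sgr_ge0. Qed.

Lemma l0norm_fin_num x : ell0 (x : nat -> R) -> l0norm x \is a fin_num.
Proof.
move=> fx; rewrite /l0norm (nneseries_finsupp fx)// => i; first by rewrite sgr_ge0.
by move/negP; rewrite negbK => /eqP ->; rewrite normr0 sgr0.
Qed.

(** One coordinate of the l0-estimate, with [a] a coordinate of the competitor
and [b] one of the sparse solution.  If [b = 0], then [sg |a|] is 1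
unless [a = 0], which pays for [beta * |a|].  If [b != 0], then only [a = 0] can lower the l0-norm,
and in that case [|a - b| >= kappa]. *)
Lemma sgr_coord_bound (beta kappa a b : R) : 0 <= beta -> 0 < kappa ->
  beta * `|a| <= 1 -> (b != 0 -> kappa <= `|b|) ->
  beta * `|a - b| + Num.sg `|b| <=
  Num.sg `|a| + (beta + kappa^-1) * (if b != 0 then `|a - b| else 0).
Proof.
move=> beta0 kappa0 betaa; have [-> _|b0 /(_ isT) kb] /= := eqVneq b 0.
  rewrite subr0 normr0 sgr0 mulr0 !addr0.
  have [->|a0] := eqVneq a 0; first by rewrite normr0 sgr0 mulr0.
  by rewrite gtr0_sg ?normr_gt0.
rewrite (gtr0_sg (x := `|b|)) ?normr_gt0// mulrDl addrCA lerD2l.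
have [->|a0] := eqVneq a 0.
  by rewrite normr0 sgr0 add0r sub0r normrN mulrC ler_pdivlMr// mul1r.
rewrite gtr0_sg ?normr_gt0// lerDl mulr_ge0// invr_ge0 ltW//.
Qed.

(** Summing the coordinate estimate over a series of nonnegative extended
reals allows [x] to have infinitely many nonzero coordinates. *)
Lemma l0norm_lower_bound (beta : R) x z : 0 <= beta ->
  (forall i, beta * `|x i| <= 1) ->
  ell0 (z : nat -> R) -> supp z !=set0 ->
  (beta%:E * l1norm (x - z)%R + l0norm z <=
   l0norm x +
   ((beta + (min_supp z)^-1) * \sum_(i \in supp z) `|x i - z i|)%R%:E)%E.
Proof.
move=> beta0 betax fz z0.
have kappa0 := min_supp_gt0 fz z0.
pose g i := if z i != 0 then `|x i - z i| else 0.
have g0 i : 0 <= g i by rewrite /g; case: ifP.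
have -> : \sum_(i \in supp z) `|x i - z i| = \sum_(i \in supp z) g i.
  by apply: eq_fsbigr => i; rewrite inE /g /supp /= => ->.
rewrite EFinM -(nneseries_finsupp fz g0); last by move=> i /negP/negPf; rewrite /g => ->.
have c0 : 0 <= beta + (min_supp z)^-1 by rewrite addr_ge0// invr_ge0 ltW.
rewrite /l1norm /l0norm -!nneseriesZl => [|i _|i _]; [|by rewrite lee_fin..].
have sg0 (u : R) : 0 <= Num.sg `|u| by rewrite sgr_ge0.
rewrite -!nneseriesD => [|i _ _|i _ _|i _ _|i _ _];
  rewrite -?EFinM ?lee_fin ?mulr_ge0//.
apply: lee_nneseries => [i _ _|i _]; rewrite -!EFinM -!EFinD lee_fin.
  by rewrite addr_ge0// mulr_ge0.
rewrite ell2_coordB; apply: (sgr_coord_bound (a := x i)) => // zi.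
exact: min_supp_le.
Qed.

(** The tangent at [z] only sees the coordinates of [x - z] on [supp z]. *)
Lemma quad_lower_bound_supp x z : ell0 (z : nat -> R) ->
  2^-1 * `|z| ^+ 2 <=
  2^-1 * `|x| ^+ 2 + linfnorm z * \sum_(i \in supp z) `|x i - z i|.
Proof.
move=> fz; rewrite -lerBlDl; have := quad_lower_bound x z.
suff : - ell2_dot z (x - z) <= linfnorm z * \sum_(i \in supp z) `|x i - z i|.
  by lra.
rewrite ell2_dot_finsupp// !fsbig_finite// mulr_sumr -sumrN.
apply: ler_sum => i _; rewrite ell2_coordB.
apply: le_trans (ler_norm _) _.
by rewrite normrN normrM ler_wpM2r// le_linfnorm.
Qed.

End Penalty.

(** * The variational source condition and its consequence for minimizers *)

Section SourceCondition.
Variables (R : realType) (Y : normedModType R) (A : {linear ell2 R -> Y}).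
Variables (Astar : dual Y -> ell2 R) (omega : nat -> dual Y) (xdag : ell2 R).
Hypothesis Astar_adj : is_adjoint A Astar.
Hypothesis omegaP : forall i : nat, ell2_unit R i = Astar (omega i).
Hypothesis xdag_ell0 : ell0 (xdag : nat -> R).
Hypothesis xdag_supp : supp xdag !=set0.

(** The coordinate [z i] is the pairing of [z] with a unit sequence, hence the
value of [omega i] at [A z]. *)
Lemma source_bound (z : ell2 R) :
  \sum_(i \in supp xdag) `|z i| <= source_const xdag omega * `|A z|.
Proof.
rewrite /source_const !fsbig_finite//= mulr_suml; apply: ler_sum => i _.
by rewrite -ell2_dot_unit omegaP Astar_adj dual_norm_ge.
Qed.

Lemma source_const_ge0 : 0 <= source_const xdag omega.
Proof. by apply: fsumr_ge0 => i _; exact: dual_norm_ge0. Qed.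

(** Since [beta] is a parameter, the inequality serves both for [x] in the ball
of radius [1 / beta], where it controls the l1-error, and for arbitrary [x],
with [beta = 0], where it only compares penalties. *)
Lemma penalty_source_inequality (beta eta : R) (x : ell2 R) : 0 <= beta ->
  0 <= eta -> (forall i, beta * `|x i| <= 1) ->
  (beta%:E * l1norm (x - xdag)%R + penalty eta xdag <= penalty eta x +
   (source_const xdag omega *
    (beta + (min_supp xdag)^-1 + eta * linfnorm xdag) *
    `|A x - A xdag|)%R%:E)%E.
Proof.
move=> beta0 eta0 betax.
have l0 := l0norm_lower_bound beta0 betax xdag_ell0 xdag_supp.
have l2 := quad_lower_bound_supp x xdag_ell0.
have S := source_bound (x - xdag); rewrite linearB in S.
set s := \sum_(i \in supp xdag) `|x i - xdag i| in l0 l2.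
have kappa0 := min_supp_gt0 xdag_ell0 xdag_supp.
have linf0 := le_trans (normr_ge0 _) (le_linfnorm xdag 0).
have c0 : 0 <= beta + (min_supp xdag)^-1 + eta * linfnorm xdag.
  by rewrite !addr_ge0 ?mulr_ge0// invr_ge0 ltW.
rewrite /penalty addeA.
apply: (@le_trans _ _ (l0norm x + ((beta + (min_supp xdag)^-1) * s)%:E +
   (eta / 2 * `|x| ^+ 2 + eta * linfnorm xdag * s)%:E)%E).
  apply: leeD => //; rewrite lee_fin.
  have := ler_wpM2l eta0 l2; lra.
rewrite -!addeA leeD2l// -!EFinD lee_fin.
have := ler_wpM2l c0 S; rewrite -/s; lra.
Qed.

(** Minimality against [xdag] bounds the excess penalty that occurs in the
source inequality; it also forces the penalty of [x] to be finite, so that the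
two can be added and the penalties cancelled. *)
Lemma tikhonov_minimizer_bound (beta q alpha eta d : R) (yd : Y) (x : ell2 R) :
  0 <= beta -> 0 < q -> 0 < alpha -> 0 <= eta ->
  `|A xdag - yd| <= d ->
  (forall i, beta * `|x i| <= 1) ->
  is_minimizer (tikhonov A yd q alpha eta) x ->
  ((q^-1 * `|A x - yd| `^ q)%R%:E + (alpha * beta)%R%:E * l1norm (x - xdag)%R
   <= (q^-1 * d `^ q + alpha * (source_const xdag omega *
    (beta + (min_supp xdag)^-1 + eta * linfnorm xdag)) * (`|A x - yd| + d))%R%:E)%E.
Proof.
move=> beta0 q0 alpha0 eta0 yd_d betax /(_ xdag).
have := penalty_source_inequality beta0 eta0 betax.
rewrite /tikhonov -2!/(penalty _ _).
set c := source_const _ _ * _.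
have -> : penalty eta xdag = (fine (penalty eta xdag))%:E.
  by rewrite fineK// /penalty fin_numD l0norm_fin_num.
have pen0 : (0 <= penalty eta x)%E.
  by rewrite adde_ge0 ?l0norm_ge0// lee_fin mulr_ge0 ?divr_ge0 ?sqr_ge0.
set t := `|A x - yd|.
have Axt : `|A x - A xdag| <= t + d.
  rewrite -(subrKA yd) (le_trans (ler_normD _ _))// lerD2l.
  by rewrite -normrN opprB.
have l10 : (0 <= l1norm (x - xdag)%R)%E.
  by apply: nneseries_ge0 => i _ _; rewrite lee_fin.
have c0 : 0 <= c.
  rewrite /c mulr_ge0 ?source_const_ge0// !addr_ge0//.
    by rewrite invr_ge0 ltW// min_supp_gt0.
  by rewrite mulr_ge0// (le_trans (normr_ge0 _) (le_linfnorm xdag 0)).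
have dq : `|A xdag - yd| `^ q <= d `^ q.
  by apply: ge0_ler_powR; rewrite ?nnegrE ?(ltW q0)// (le_trans _ yd_d).
move: (fine _) => p.
rewrite [(alpha * beta)%:E]EFinM -muleA; have : (0 <= beta%:E * l1norm (x - xdag)%R)%E.
  by rewrite mule_ge0// lee_fin.
case: (penalty eta x) pen0 => [r _|_ _ _|//]; last first.
  by rewrite gt0_muley ?lte_fin// addey.
move: (beta%:E * _)%E => [l _|//|//].
rewrite -!EFinM -!EFinD !lee_fin => V M.
have := ler_wpM2l (ltW alpha0) V.
have qi0 : 0 <= q^-1 by rewrite invr_ge0 ltW.
have := ler_wpM2l qi0 dq.
have := ler_wpM2l (mulr_ge0 (ltW alpha0) c0) Axt.
lra.
Qed.

End SourceCondition.

Theorem theorem4 (R : realType) (Y : completeNormedModType R)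
  (A : {linear ell2 R -> Y}) (Astar : dual Y -> ell2 R)
  (y : Y) (xdag : ell2 R) (omega : nat -> dual Y)
  (q eta delta : R) (yd : Y) (xmin : R -> ell2 R)
  (rho alpha0 nu tau : R) (jstar : nat)
  (Yinf : infinite_dimensional Y)
  (Abnd : bounded_near A (nbhs (0 : ell2 R)))
  (Ainj : injective A)
  (Astar_adj : is_adjoint A Astar)
  (Arange : ~ closed (range A))
  (Axdag : A xdag = y)
  (xdag_ell0 : ell0 (xdag : nat -> R))
  (xdag_supp : supp xdag !=set0)
  (omegaP : forall i : nat, ell2_unit R i = Astar (omega i))
  (q_gt1 : 1 < q) (eta_gt0 : 0 < eta) (delta_gt0 : 0 < delta)
  (yd_delta : `|y - yd| <= delta)
  (xminP : forall alpha : R, 0 < alpha ->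
     is_minimizer (tikhonov A yd q alpha eta) (xmin alpha))
  (rho_gt0 : 0 < rho) (alpha0_gt0 : 0 < alpha0)
  (nu_gt0 : 0 < nu) (nu_lt1 : nu < 1) (tau_gt1 : 1 < tau)
  (jstar_gt0 : (0 < jstar)%N)
  (disc_le : `|A (xmin (nu ^+ jstar * alpha0)) - yd| <= tau * delta)
  (disc_gt : tau * delta < `|A (xmin (nu ^+ jstar.-1 * alpha0)) - yd|)
  (xmin_ball : sparse_ball rho (xmin (nu ^+ jstar * alpha0))) :
  (l1norm (xmin (nu ^+ jstar * alpha0) - xdag)%R <=
   (C2_const rho (c0_const rho eta xdag omega) q tau nu * delta)%R%:E)%E.
Proof.
have [_ xmin_rho] := xmin_ball.
have q0 : 0 < q by lra.
have ydd : `|A xdag - yd| <= delta by rewrite Axdag.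
(* [a1] is the last rejected parameter and [a], below, the accepted one. *)
set a1 := nu ^+ jstar.-1 * alpha0 in disc_gt.
have a1_gt0 : 0 < a1 by rewrite mulr_gt0// exprn_gt0.
have aE : nu ^+ jstar * alpha0 = nu * a1.
  by rewrite mulrA -exprS prednK.
rewrite aE in disc_le xmin_rho *; set a := nu * a1 in disc_le xmin_rho *.
have a_gt0 : 0 < a by rewrite mulr_gt0.
set c0 := c0_const rho eta xdag omega.
set L := l1norm _.
have rho_coord i : rho^-1 * `|xmin a i| <= 1.
  by rewrite ler_pdivrMl// mulr1 (le_trans (ell2_coord_le _ _)).
have rhoi0 : 0 <= rho^-1 by rewrite invr_ge0 ltW.
have K0 := source_const_ge0 omega xdag.
have err := tikhonov_minimizer_bound Astar_adj omegaP xdag_ell0 xdag_supp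
  rhoi0 q0 a_gt0 (ltW eta_gt0) ydd rho_coord (xminP _ a_gt0).
have zero_coord i : 0 * `|xmin a1 i| <= 1 by rewrite mul0r.
have := tikhonov_minimizer_bound Astar_adj omegaP xdag_ell0 xdag_supp
  (lexx 0) q0 a1_gt0 (ltW eta_gt0) ydd zero_coord (xminP _ a1_gt0).
rewrite mulr0 mul0e adde0 lee_fin => par.
rewrite -[source_const _ _ * (rho^-1 + _ + _)]/c0 -/L in err.
set t := `|A (xmin a1) - yd| in disc_gt par.
have c0_ge : source_const xdag omega *
    (0 + (min_supp xdag)^-1 + eta * linfnorm xdag) <= c0.
  by rewrite ler_wpM2l// !lerD2r.
have t_gt : delta < t by apply: lt_trans disc_gt; rewrite ltr_pMl.
have td0 : 0 <= t + delta by lra.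
have tdq : 0 < t `^ q - delta `^ q.
  by rewrite subr_gt0 gt0_ltr_powR// nnegrE; lra.
have dq1 : 0 < delta `^ (q - 1) by rewrite powR_gt0.
have := powR_quotient_bound q_gt1 tau_gt1 delta_gt0 (ltW disc_gt).
rewrite /C2_const; set C := (_ `^ _ * (_ / _)) => tC.
have c00 : 0 <= c0.
  by rewrite (le_trans _ c0_ge)// mulr_ge0// add0r addr_ge0 ?invr_ge0
    ?(ltW (min_supp_gt0 _ _))// mulr_ge0 ?(ltW eta_gt0)//
    (le_trans (normr_ge0 _) (le_linfnorm xdag 0)).
(* The lower bound on the parameter: the estimate at the rejected minimizer is
   multiplied by [delta^q] and then divided by [t^q - delta^q]. *)
have par' : q^-1 * delta `^ q <= a1 * c0 * delta * C.
  rewrite -(ler_pM2r tdq).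
  have dqE := powR_pred q delta_gt0.
  have h1 : q^-1 * (t `^ q - delta `^ q) <= a1 * c0 * (t + delta).
    have := ler_wpM2r td0 (ler_wpM2l (ltW a1_gt0) c0_ge); lra.
  have h2 := ler_wpM2l (mulr_ge0 (ltW dq1) (ltW delta_gt0)) h1.
  have h3 := ler_wpM2l (mulr_ge0 (mulr_ge0 (ltW a1_gt0) c00) (ltW delta_gt0)) tC.
  by rewrite dqE in h1 h2 h3 *; lra.
have L0 : (0 <= L)%E by apply: nneseries_ge0 => i _ _; rewrite lee_fin.
have ar0 : 0 < a * rho^-1 by rewrite mulr_gt0 ?invr_gt0.
clearbody L; case: L L0 err => [l _ err|_|//]; last first.
  by rewrite gt0_muley ?lte_fin// addey.
rewrite -EFinM -EFinD !lee_fin in err *.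
have sq0 : 0 <= q^-1 * `|A (xmin a) - yd| `^ q.
  by rewrite mulr_ge0 ?powR_ge0// invr_ge0 ltW.
have disc := ler_wpM2l (mulr_ge0 (ltW a_gt0) c00) disc_le.
have a1E : a1 = a * nu^-1 by rewrite /a mulrAC divff ?mul1r// gt_eqF.
rewrite a1E in par'.
rewrite -(ler_pM2l ar0).
have -> : a / rho * (rho * c0 * (C * nu^-1 + tau + 1) * delta) =
  a / nu * c0 * delta * C + a * c0 * (tau * delta) + a * c0 * delta.
  by field; rewrite !gt_eqF.
lra.
Qed.
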